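(* Let $p$ be a prime, $N=p^e$ with $e\ge 1$, let $h\ge 1$ be a divisor of $N-1$, put $A=(N-1)/h$ and $$\Lambda_{N,h}(U)=U\,(U^A-1)^h\in\mathbb F_p[U].$$ Let $k$ be an algebraically closed field of characteristic $p$. Then the polynomial cover $$\lambda_{N,h}:\mathbb P^1_U\longrightarrow\mathbb P^1_T,\qquad T=\Lambda_{N,h}(U),$$ over $k$ has degree $N$. Its geometric Galois closure (the Galois closure of $k(U)/k(T)$) is the rational function field $k(z)$ with $$U=z^h,\qquad T=(z^N-z)^h.$$ The geometric monodromy group, in its degree $N$ action, is $$G_{N,h}=(\mathbb F_N,+)\rtimes H_h$$ acting naturally on $\mathbb F_N$, where $H_h\le\mathbb F_N^\times$ is the subgroup of order $h$. The only possible finite branch value of $\lambda_{N,h}$ is $0$. Above $T=0$, the point $U=0$ is unramified and the roots of $U^A=1$ have ramification index $h$. The point $\infty_U$ lies above $\infty_T$ and is totally ramified. Hence the set of branch values is $\{0,\infty\}$ if $h>1$, and $\{\infty\}$ if $h=1$.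
   Context: The geometric monodromy group of the cover is $\mathrm{Gal}(L/k(T))$, where $L$ is the Galois closure of $k(U)/k(T)$, acting on the $N$-element set $\mathrm{Hom}_{k(T)}(k(U),L)$ (equivalently, on the $N$ roots of $\Lambda_{N,h}(X)-T$ in $L$). The natural action of $G_{N,h}=(\mathbb F_N,+)\rtimes H_h$ on $\mathbb F_N$ is by the maps $x\mapsto \alpha x+b$ with $\alpha\in H_h$, $b\in\mathbb F_N$. A branch value is a point of $\mathbb P^1_T(k)$ above which some point has ramification index greater than one; it is finite if it lies in $\mathbb A^1_T$. *)

(* Defs.v *)
From HB Require Import structures.
From mathcomp Require Import all_boot all_order all_fingroup all_algebra.
From mathcomp Require Import all_solvable all_field.
From mathcomp Require Import generic_quotient.

Set Implicit Arguments.
Unset Strict Implicit.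
Unset Printing Implicit Defensive.

Import GRing.Theory.
Local Open Scope ring_scope.

(* The coefficients are in the prime ring, so over a field of characteristic p
   this is the image of the polynomial of 'F_p[U] of the same name. *)
Definition Lambda (R : nzRingType) (N h : nat) : {poly R} :=
  'X * ('X^(N.-1 %/ h) - 1) ^+ h.

Lemma subf_div (F : fieldType) (a b c d : F) : b != 0 -> d != 0 ->
  a / b - c / d = (a * d - c * b) / (b * d).
Proof. by move=> b0 d0; rewrite -mulNr addf_div // mulNr. Qed.

(* {ratfun k} is the rational function field in one variable over k, used for
   k(T), k(U) and k(z) alike; x%:RF embeds k[X] into it. *)
Notation "{ 'ratfun' k }" := {fraction {poly k}}
  (format "{ 'ratfun'  k }") : type_scope.
Notation "p %:RF" := (@FracField.tofrac {poly _} p)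
  (at level 2, left associativity, format "p %:RF") : ring_scope.

Section RationalFunctions.

Variable k : fieldType.
Implicit Types (x : {ratfun k}) (p q f : {poly k}).

Definition numrf x : {poly k} := (\n_(repr x))%R.
Definition denrf x : {poly k} := (\d_(repr x))%R.

Lemma denrf_neq0 x : denrf x != 0.
Proof. exact: denom_ratioP. Qed.

Lemma eq_divrf p q p' q' : q != 0 -> q' != 0 ->
  (p%:RF / q%:RF == p'%:RF / q'%:RF) = (p * q' == p' * q).
Proof.
by move=> q0 q'0; rewrite eqr_div ?tofrac_eq0 // -!tofracM tofrac_eq.
Qed.

Lemma divrfE x : x = (numrf x)%:RF / (denrf x)%:RF.
Proof.
apply: (canRL (mulfK _)); first by rewrite tofrac_eq0 denrf_neq0.
have pi_ratio (r : {ratio {poly k}}) :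
    (\pi_({fraction {poly k}})%qT r : {ratfun k}) * (\d_r)%:RF = (\n_r)%:RF.
  unlock FracField.tofrac; rewrite -[LHS]FracField.pi_mul.
  apply/eqmodP; rewrite /= FracField.equivfE /FracField.mulf.
  by rewrite !numden_Ratio ?(oner_neq0, mulf_neq0, denom_ratioP) // !mulr1 mulrC.
by have := pi_ratio (repr x); rewrite reprK.
Qed.

Lemma comp_poly_eq0f f p : (1 < size f)%N -> (p \Po f == 0) = (p == 0).
Proof.
move=> f1; apply/eqP/eqP=> [pf0 | ->]; last exact: comp_poly0.
have := size_comp_poly p f; rewrite pf0 size_poly0 => /esym/eqP.
rewrite muln_eq0 -!subn1 [in X in _ || X]subn_eq0 leqNgt f1 orbF subn_eq0.
by move/size1_polyC=> pC; move: pf0; rewrite pC comp_polyC.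
Qed.

(* The substitution x(X) |-> x(f(X)). For constant f it is not defined on all
   of k(X), and we let it be the identity. *)
Definition pullback f x : {ratfun k} :=
  if (1 < size f)%N then (numrf x \Po f)%:RF / (denrf x \Po f)%:RF else x.

Lemma pullback_div f p q : (1 < size f)%N -> q != 0 ->
  pullback f (p%:RF / q%:RF) = (p \Po f)%:RF / (q \Po f)%:RF.
Proof.
move=> f1 q0; rewrite /pullback f1.
set x := p%:RF / q%:RF; have d0 := denrf_neq0 x.
apply/eqP; rewrite eq_divrf ?comp_poly_eq0f //.
rewrite -!comp_polyM; apply/eqP; congr (_ \Po f).
by apply/eqP; rewrite -eq_divrf // -divrfE.
Qed.

Lemma pullback_poly f p : (1 < size f)%N -> pullback f p%:RF = (p \Po f)%:RF.
Proof.
move=> f1; rewrite -[p%:RF]divr1 -tofrac1 pullback_div ?oner_neq0 //.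
by rewrite comp_polyC tofrac1 divr1.
Qed.

Lemma pullback_is_zmod_morphism f : zmod_morphism (pullback f).
Proof.
move=> x y; case f1: (1 < size f)%N; last by rewrite /pullback f1.
have x0 := denrf_neq0 x; have y0 := denrf_neq0 y.
have nx : (denrf x \Po f)%:RF != 0 by rewrite tofrac_eq0 comp_poly_eq0f.
have ny : (denrf y \Po f)%:RF != 0 by rewrite tofrac_eq0 comp_poly_eq0f.
rewrite [in LHS](divrfE x) [in LHS](divrfE y) subf_div ?tofrac_eq0 //.
rewrite -!tofracM -tofracB pullback_div ?mulf_neq0 //.
rewrite comp_polyB !comp_polyM tofracB !tofracM.
by rewrite /pullback f1; symmetry; apply: subf_div nx ny.
Qed.

Lemma pullback_is_monoid_morphism f : monoid_morphism (pullback f).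
Proof.
split=> [|x y]; case f1: (1 < size f)%N; try by rewrite /pullback f1.
  by rewrite -tofrac1 pullback_poly // comp_polyC.
have x0 := denrf_neq0 x; have y0 := denrf_neq0 y.
rewrite [in LHS](divrfE x) [in LHS](divrfE y) mulf_div.
rewrite -!tofracM pullback_div ?mulf_neq0 //.
rewrite !comp_polyM !tofracM.
by rewrite /pullback f1 [RHS]mulf_div.
Qed.

HB.instance Definition _ f := GRing.isZmodMorphism.Build
  {ratfun k} {ratfun k} (pullback f) (pullback_is_zmod_morphism f).
HB.instance Definition _ f := GRing.isMonoidMorphism.Build
  {ratfun k} {ratfun k} (pullback f) (pullback_is_monoid_morphism f).

(* Points of the projective line: Some a is the affine point a, None is the
   point at infinity. *)
Definition proj_line := option k.

(* For x != 0 only. *)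
Definition ord (P : proj_line) x : int :=
  if P is Some a then (mup a (numrf x))%:Z - (mup a (denrf x))%:Z
  else (size (denrf x))%:Z - (size (numrf x))%:Z.

Definition uniformizer (P : proj_line) : {ratfun k} :=
  if P is Some a then ('X - a%:P)%:RF else ('X%:RF)^-1.

(* A finite cover of the projective line by itself is given by its embedding
   i : k(T) -> k(U) of function fields. A point P of the source lies over Q iff
   the maximal ideal of the valuation ring at Q maps into that at P, and then
   ram_index i P Q is the ramification index of i at P. *)
Definition ram_index (i : {rmorphism {ratfun k} -> {ratfun k}})
    (P Q : proj_line) : int :=
  ord P (i (uniformizer Q)).

Definition lies_over (i : {rmorphism {ratfun k} -> {ratfun k}})
    (P Q : proj_line) : Prop :=
  0 < ram_index i P Q.

Definition branch_value (i : {rmorphism {ratfun k} -> {ratfun k}})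
    (Q : proj_line) : Prop :=
  exists2 P, lies_over i P Q & 1 < ram_index i P Q.

End RationalFunctions.

(* phi identifies K, made an extension of F by means of i, with L. *)
Definition ext_iso (F K : fieldType) (i : {rmorphism F -> K})
    (L : fieldExtType F) (phi : {rmorphism K -> L}) : Prop :=
  bijective phi /\ forall x, phi (i x) = x%:A.

Definition ext_degree (F K : fieldType) (i : {rmorphism F -> K}) (n : nat)
    : Prop :=
  exists (L : fieldExtType F) (phi : {rmorphism K -> L}),
    ext_iso i phi /\ \dim {:L} = n.

(* F-embeddings into L of K, viewed as an extension of F by means of i. *)
Definition ext_hom (F K : fieldType) (i : {rmorphism F -> K})
    (L : fieldExtType F) (f : {rmorphism K -> L}) : Prop :=
  forall x, f (i x) = x%:A.

(* j : K -> L is a Galois closure of the extension i : F -> K. *)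
Definition is_galois_closure (F K : fieldType) (i : {rmorphism F -> K})
    (L : splittingFieldType F) (j : {rmorphism K -> L}) : Prop :=
  [/\ ext_hom i j, galois 1 {:L}
    & forall M : {subfield L},
        (forall y, j y \in M) -> galois 1 M -> (M = {:L} :> {vspace L})%VS].

Section AffineGroup.

Variable F : finFieldType.

Lemma affine_inj (a : {unit F}) (b : F) :
  injective (fun x : F => FinRing.uval a * x + b).
Proof. by move=> x y /addIr; apply: (can_inj (mulKr (valP a))). Qed.

Definition affine (a : {unit F}) (b : F) : {perm F} := perm (@affine_inj a b).

(* (F, +) ><| H as a permutation group of F; ><| is the internal semidirect
   product, with (F, +) acting by translations and H by multiplication. *)
Definition affine_group (H : {set {unit F}}) : {set {perm F}} :=
  ([set affine 1 b | b : F] ><| [set affine a 0 | a in H])%g.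

Lemma affineM a b c d :
  (affine a b * affine c d)%g =
  affine (c * a)%g (FinRing.uval c * b + d).
Proof. by apply/permP=> x; rewrite permM !permE /= mulrDr mulrA addrA. Qed.

Lemma affine1 : affine 1%g 0 = 1%g.
Proof. by apply/permP=> x; rewrite !permE /= mul1r addr0. Qed.

Lemma affine_groupE (H : {group {unit F}}) :
  affine_group H = [set affine a b | a in H, b in [set: F]].
Proof.
pose A := [set affine 1%g b | b : F]; pose B := [set affine a 0 | a in H].
have gA : group_set A.
  apply/group_setP; split; first by apply/imsetP; exists 0; rewrite ?affine1.
  move=> _ _ /imsetP[b _ ->] /imsetP[c _ ->]; apply/imsetP.
  by exists (b + c); rewrite // affineM /= mul1r mulg1.
have gB : group_set B.
  apply/group_setP; split; first by apply/imsetP; exists 1%g; rewrite ?affine1.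
  move=> _ _ /imsetP[a Ha ->] /imsetP[c Hc ->]; apply/imsetP.
  by exists (c * a)%g; rewrite ?groupM // affineM /= mulr0 addr0.
have tiAB : A :&: B = 1%g.
  apply/eqP; rewrite eqEsubset; apply/andP; split; last first.
    by rewrite sub1set inE (group1 (Group gA)) (group1 (Group gB)).
  apply/subsetP=> g.
  case/setIP=> /imsetP[b _ ->] /imsetP[a _ /permP/(_ 0)].
  by rewrite !permE /= !mulr0 !add0r => ->; rewrite affine1 set11.
have nAB : B \subset 'N(A)%g.
  apply/subsetP=> _ /imsetP[a _ ->]; rewrite inE.
  apply/subsetP=> _ /imsetP[_ /imsetP[b _ ->] ->]; apply/imsetP.
  exists (FinRing.uval a * b) => //.
  apply: (mulgI (affine a 0)); rewrite conjgE mulKVg !affineM /=.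
  by rewrite mulg1 mul1g mulr0 add0r !addr0.
rewrite /affine_group -/A -/B (@sdprodE _ (Group gA) (Group gB)) //=.
apply/setP=> g; apply/mulsgP/imset2P.
  case=> _ _ /imsetP[b _ ->] /imsetP[a Ha ->] ->.
  by exists a (FinRing.uval a * b); rewrite ?inE // affineM mulg1 addr0.
case=> a b Ha _ ->; exists (affine 1%g (FinRing.uval a^-1%g * b)) (affine a 0).
- by apply/imsetP; eexists.
- by apply/imsetP; exists a.
by rewrite affineM mulg1 addr0 /= mulrA mulrV ?mul1r // (valP a).
Qed.

End AffineGroup.

(* Gal(L/F) acts by composition on the finite set of F-embeddings of K into L,
   and this action is isomorphic to that of the permutation group G on S. *)
Definition monodromy_iso (F K : fieldType) (i : {rmorphism F -> K})
    (L : splittingFieldType F) (S : finType) (G : {set {perm S}}) : Prop :=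
  exists (sigma : S -> {rmorphism K -> L})
         (psi : {morphism 'Gal({:L} / 1)%g >-> {perm S}}),
    [/\ forall s, ext_hom i (sigma s),
        forall s t, sigma s =1 sigma t -> s = t,
        forall f : {rmorphism K -> L}, ext_hom i f -> exists s, f =1 sigma s,
        isom 'Gal({:L} / 1)%g G psi
      & forall g, g \in 'Gal({:L} / 1)%g ->
          forall s y, g (sigma s y) = sigma (psi g s) y].

(* Main.v *)
(** The composite of z |-> z^h with Lambda is (z^N - z)^h, and k(X)/k(f) has
    degree deg f for every nonconstant f, since f(Y) - T is the minimal
    polynomial of X over k(T). Embed F_N in k. For a in H_h and b in F_N the
    substitution z |-> a z + b multiplies z^N - z by a, hence fixes (z^N - z)^h;
    the N h elements a z + b are therefore the roots of (Y^N - Y)^h - T, so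
    that k(z)/k(T) is Galois and its automorphisms are these substitutions.
    The N conjugates of U = z^h are the (z + s)^h with s in F_N, and
    z |-> a z + b permutes them by s |-> (s + b) / a. This action is faithful
    and transitive, so no proper Galois subextension contains U.

    For the ramification, h A = N - 1 = -1 in k gives
    Lambda' = - (U^A - 1)^(h - 1), so a multiple root of Lambda - t is a root of
    U^A - 1, which forces t = 0 and h > 1. *)

Require Import Defs.
From HB Require Import structures.
From mathcomp Require Import all_boot all_order all_fingroup all_algebra.
From mathcomp Require Import all_solvable all_field.

Set Implicit Arguments.
Unset Strict Implicit.
Unset Printing Implicit Defensive.

Import GRing.Theory Num.Theory.
Local Open Scope ring_scope.

(** * Embedding a finite field in an algebraically closed one *)

(** Since [K] is F[w], evaluation at [w] is onto and its kernel lies in that of evaluation at [r],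
    so the latter factors through it. *)
Lemma fmorph_adjoin_extend (F K K' : fieldType) (i : {rmorphism F -> K})
    (i' : {rmorphism F -> K'}) (w : K) (r : K') :
    (forall x, exists q, (map_poly i q).[w] = x) ->
    (forall q, (map_poly i q).[w] = 0 -> (map_poly i' q).[r] = 0) ->
  exists iota : {rmorphism K -> K'},
    forall q, iota (map_poly i q).[w] = (map_poly i' q).[r].
Proof.
move=> genw wr; have genw' x : exists q, (map_poly i q).[w] == x.
  by have [q <-] := genw x; exists q.
pose iota x := (map_poly i' (xchoose (genw' x))).[r].
have iotaE q : iota (map_poly i q).[w] = (map_poly i' q).[r].
  apply/eqP; rewrite /iota -subr_eq0 -hornerN -hornerD -rmorphB wr //.
  by rewrite rmorphB hornerD hornerN (eqP (xchooseP (genw' _))) subrr.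
have iotaB : zmod_morphism iota.
  move=> x y; have [[q <-] [q' <-]] := (genw x, genw y).
  by rewrite -hornerN -hornerD -rmorphB !iotaE rmorphB hornerD hornerN.
have iotaM : monoid_morphism iota.
  split=> [|x y]; last first.
    have [[q <-] [q' <-]] := (genw x, genw y).
    by rewrite -hornerM -rmorphM !iotaE rmorphM hornerM.
  by have := iotaE 1; rewrite !rmorph1 !hornerC.
pose iA := GRing.isZmodMorphism.Build K K' iota iotaB.
pose iR := GRing.isMonoidMorphism.Build K K' iota iotaM.
by exists (HB.pack_for {rmorphism K -> K'} iota iA iR).
Qed.

Lemma finField_generator (F : finFieldType) :
  exists w : F, forall x : F, x != 0 -> exists n, x = w ^+ n.
Proof.
have /cyclicP[w wP] := field_unit_group_cyclic [set: {unit F}].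
exists (FinRing.uval w) => x x0.
have xu : x \is a GRing.unit by rewrite unitfE.
have /cycleP[n xn] : FinRing.unit F xu \in <[w]>%g by rewrite -wP inE.
by exists n; rewrite -FinRing.val_unitX -xn.
Qed.

(** A generator [w] of the unit group generates [F] over the prime field, and sending it to a root
    in [k] of its minimal polynomial defines the embedding. *)
Lemma finField_closed_embedding (F : finFieldType) (k : closedFieldType) p :
  p \in [pchar F] -> p \in [pchar k] -> inhabited {rmorphism F -> k}.
Proof.
move=> pF pk; pose E := pPrimeCharType pF; pose k' := pPrimeCharType pk.
have [w wP] := finField_generator F.
have /polyOver1P[P PE] := minPolyOver 1%AS (w : E).
have [r rP] : exists r : k', root (map_poly (in_alg k') P) r.
  have sP : size (map_poly (in_alg k') P) != 1%N.
    by rewrite size_map_poly -(size_map_poly (in_alg E)) -PE size_minPoly.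
  exact: (elimT (@closed_rootP k _) sP).
have [|q qw|iota _] :=
  @fmorph_adjoin_extend 'F_p E k' (in_alg E) (in_alg k') w r.
- move=> x; have [->|/wP[n ->]] := eqVneq x 0.
    by exists 0; rewrite rmorph0 horner0.
  by exists 'X^n; rewrite map_polyXn hornerXn.
(* Every relation satisfied by [w] is a multiple of its minimal polynomial, hence holds for [r]. *)
- have : minPoly 1 (w : E) %| map_poly (in_alg E) q.
    by apply: minPoly_dvdp; [apply/polyOver1P; exists q | apply/eqP].
  rewrite PE dvdp_map => /dvdpP[q' ->].
  by rewrite rmorphM hornerM (rootP rP) mulr0.
exact: (inhabits iota).
Qed.

(** * Ramification *)

Section Orders.

Variable k : fieldType.
Implicit Types (p q f : {poly k}) (a t : k).

(** [ord] is computed on a chosen representative. Any other fraction is tied to it by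
    cross-multiplication, and multiplicities and degrees are additive on products. *)
Lemma ord_div (P : proj_line k) p q : p != 0 -> q != 0 ->
  ord P (p%:RF / q%:RF) =
  if P is Some a then (mup a p)%:Z - (mup a q)%:Z
  else (size q)%:Z - (size p)%:Z.
Proof.
move=> p0 q0; set x := p%:RF / q%:RF; have d0 := denrf_neq0 x.
have E : p * denrf x = numrf x * q.
  by apply/eqP; rewrite -eq_divrf // -divrfE.
have n0 : numrf x != 0.
  by apply: contraNneq (mulf_neq0 p0 d0) => n0; rewrite E n0 mul0r.
have subzE m n m' n' : (m + n' = m' + n)%N -> m%:Z - n%:Z = m'%:Z - n'%:Z.
  move=> e; apply/eqP.
  by rewrite subr_eq addrAC eq_sym subr_eq -!PoszD e.
case: P => [a|] /=; apply: subzE.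
  by rewrite -mupM // -E mupM // addnC.
(* The size of a product carries a predecessor, which the successor cancels. *)
have /(congr1 S) := congr1 (fun r : {poly k} => size r) E.
rewrite !size_mul // !prednK ?addn_gt0 ?size_poly_gt0 ?p0 ?n0 // => e.
by rewrite addnC e addnC.
Qed.

Lemma ord_poly (P : proj_line k) p : p != 0 ->
  ord P p%:RF = if P is Some a then (mup a p)%:Z else 1 - (size p)%:Z.
Proof.
move=> p0; rewrite -[p%:RF]divr1 -tofrac1 ord_div ?oner_neq0 //.
case: P => [a|]; last by rewrite size_poly1.
by rewrite (@mupNroot _ _ 1) ?subr0 ?root1.
Qed.

Lemma size_subC f t : (1 < size f)%N -> size (f - t%:P) = size f.
Proof.
move=> f1.
by rewrite size_polyDl // size_polyN (leq_ltn_trans (size_polyC_leq1 t)).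
Qed.

(** At infinity the value is minus the degree, so infinity lies over no finite point. *)
Lemma ram_index_finite f (P : proj_line k) t : (1 < size f)%N ->
  ram_index (pullback f) P (Some t) =
  if P is Some a then (mup a (f - t%:P))%:Z else 1 - (size f)%:Z.
Proof.
move=> f1; have sf := size_subC t f1.
rewrite /ram_index /= pullback_poly // comp_polyB comp_polyX comp_polyC.
by rewrite ord_poly ?sf // -size_poly_gt0 sf ltnW.
Qed.

(** The uniformizer 1/T becomes 1/f, whose order at a finite point is at most 0, so only infinity
    can lie over infinity. *)
Lemma ram_index_infty f (P : proj_line k) : (1 < size f)%N ->
  ram_index (pullback f) P None =
  if P is Some a then - (mup a f)%:Z else (size f)%:Z - 1.
Proof.
move=> f1; rewrite /ram_index /= fmorphV /= pullback_poly // comp_polyX.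
rewrite -div1r -tofrac1 ord_div ?oner_neq0 -?size_poly_gt0 1?ltnW //.
case: P => [a|]; last by rewrite size_poly1.
by rewrite (@mupNroot _ _ 1) ?sub0r ?root1.
Qed.

Lemma mup_gt1_root_deriv a p : (1 < mup a p)%N -> root p^`() a.
Proof.
have [->|p0] := eqVneq p 0; first by rewrite deriv0 root0.
rewrite mup_geq // => /dvdpP[q ->].
have: ('X - a%:P).[a] = 0 by rewrite hornerXsubC subrr.
move: ('X - _) => r ra.
rewrite rootE expr2 mulrA derivM derivM hornerD !hornerM.
by rewrite ra !mulr0 mul0r addr0.
Qed.

Lemma mup_exp a p n : p != 0 -> mup a (p ^+ n) = (n * mup a p)%N.
Proof.
move=> p0; elim: n => [|n IHn]; first by rewrite mupNroot ?expr0 ?root1.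
by rewrite exprS mupM ?expf_neq0 // IHn mulSn.
Qed.

End Orders.

(** * Branch values and ramification indices of [Lambda] *)

Section Lambda.

Variables (k : fieldType) (p N h A : nat).
Hypotheses (hk : p \in [pchar k]) (pN : (p %| N)%N) (N1 : (1 < N)%N).
Hypotheses (h0 : (0 < h)%N) (hA : N.-1 = (A * h)%N).

Let NE : N = (A * h).+1. Proof. by rewrite -hA prednK // ltnW. Qed.
Let A0 : (0 < A)%N.
Proof. by move: N1; rewrite NE ltnS muln_gt0 => /andP[]. Qed.

Lemma LambdaE : Lambda k N h = 'X * ('X^A - 1) ^+ h.
Proof. by rewrite /Lambda hA mulnK. Qed.

Lemma natr_mulhA : (h * A)%:R = -1 :> k.
Proof.
apply/eqP; rewrite -subr_eq0 opprK natr1 mulnC -NE.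
by rewrite -(dvdn_pcharf hk).
Qed.

Lemma size_XA_sub1 : size ('X^A - 1 : {poly k}) = A.+1.
Proof. exact: size_XnsubC. Qed.

Lemma XA_sub1_neq0 : ('X^A - 1 : {poly k}) != 0.
Proof. by rewrite -size_poly_gt0 size_XA_sub1. Qed.

Lemma size_Lambda : size (Lambda k N h) = N.+1.
Proof.
rewrite LambdaE mulrC size_mulX ?expf_neq0 ?XA_sub1_neq0 //.
have := size_exp ('X^A - 1 : {poly k}) h; rewrite size_XA_sub1 /= => e.
by rewrite -[size _]prednK ?size_poly_gt0 ?expf_neq0 ?XA_sub1_neq0 // e NE.
Qed.

Lemma size_Lambda_gt1 : (1 < size (Lambda k N h))%N.
Proof. by rewrite size_Lambda ltnS ltnW. Qed.

(* The derivative is a power because [h * A = N - 1 = -1] in [k]. *)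
Lemma deriv_Lambda : (Lambda k N h)^`() = - ('X^A - 1) ^+ h.-1.
Proof.
rewrite LambdaE derivM derivX mul1r deriv_exp derivB derivXn derivC subr0.
have -> : 'X * ('X^(A.-1) *+ A * ('X^A - 1) ^+ h.-1 *+ h) =
    - ('X^A * ('X^A - 1) ^+ h.-1) :> {poly k}.
  rewrite mulrnAl -mulrnA mulnC -mulr_natl mulrCA ['X * _]mulrA -exprS.
  rewrite prednK //.
  by rewrite -polyC_natr natr_mulhA polyCN mulN1r.
by rewrite -{1}(prednK h0) exprS mulrBl mul1r addrAC subrr add0r.
Qed.

Lemma branch_value_Lambda t :
  branch_value (pullback (Lambda k N h)) (Some t) -> t = 0 /\ (1 < h)%N.
Proof.
case=> P; rewrite /lies_over ram_index_finite ?size_Lambda_gt1 //.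
case: P => [a|]; last first.
  by rewrite size_Lambda subr_gt0 ltz_nat ltnS ltn0.
move=> m0; rewrite ltz_nat => m1; have := mup_gt1_root_deriv m1.
(* A zero of the derivative yields both [0 < h.-1], hence [1 < h], and a^A = 1. *)
rewrite derivB derivC subr0 deriv_Lambda rootN rootE
   horner_exp expf_eq0 => /andP[h1 /rootP ra].
split; last by case: (h) h1 => [|[]].
have s0 : Lambda k N h - t%:P != 0.
  by rewrite -size_poly_gt0 size_subC size_Lambda // ltnS ltnW.
have: root (Lambda k N h - t%:P) a by rewrite -dvdp_XsubCl XsubC_dvd // ltnW.
rewrite rootE LambdaE hornerD hornerN hornerC hornerM horner_exp ra.
by rewrite expr0n gtn_eqF // mulr0 sub0r oppr_eq0 => /eqP.
Qed.

Lemma ram_index_Lambda0 :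
  ram_index (pullback (Lambda k N h)) (Some 0) (Some 0) = 1.
Proof.
rewrite ram_index_finite ?size_Lambda_gt1 // subr0 LambdaE // mupMl.
  by rewrite -[X in mup _ X]subr0 -(polyC0 k) (@mup_XsubCX _ 1) eqxx.
rewrite rootE horner_exp !hornerE expr0n gtn_eqF // sub0r expf_eq0 oppr_eq0.
by rewrite oner_eq0 andbF.
Qed.

Lemma ram_index_Lambda_root (u : k) : u ^+ A = 1 ->
  ram_index (pullback (Lambda k N h)) (Some u) (Some 0) = h%:Z.
Proof.
move=> uA; have q0 := XA_sub1_neq0.
have u0 : u != 0.
  apply: contra_eq_neq uA => ->.
  by rewrite expr0n gtn_eqF // eq_sym oner_eq0.
rewrite ram_index_finite ?size_Lambda_gt1 // subr0 LambdaE //.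
rewrite mupMr ?rootE ?hornerX //.
rewrite mup_exp // [mup _ _](_ : _ = 1%N) ?muln1 //.
apply/eqP; rewrite eqn_leq -XsubC_dvd // dvdp_XsubCl; apply/andP; split.
  (* The root [u] of U^A - 1 is simple: the derivative A u^(A - 1) vanishes only if A = 0 in [k],
     contradicting h A = -1. *)
  rewrite leqNgt; apply/negP => /mup_gt1_root_deriv.
  rewrite derivB derivC subr0 derivXn rootE hornerMn hornerXn.
  rewrite -mulr_natl mulf_eq0.
  rewrite (negPf (expf_neq0 _ u0)) orbF => /eqP A_0.
  by have /eqP := natr_mulhA; rewrite natrM A_0 mulr0 eq_sym oppr_eq0 oner_eq0.
by rewrite rootE !hornerE uA subrr.
Qed.

Lemma ram_index_Lambda_infty :
  ram_index (pullback (Lambda k N h)) None None = N%:Z.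
Proof.
rewrite ram_index_infty ?size_Lambda_gt1 // size_Lambda // -addn1 PoszD.
exact: addrK.
Qed.

Lemma branch_value_Lambda_infty : branch_value (pullback (Lambda k N h)) None.
Proof.
by exists None; rewrite ?/lies_over ram_index_Lambda_infty ltz_nat // ltnW.
Qed.

Lemma branch_value_Lambda0 :
  branch_value (pullback (Lambda k N h)) (Some 0) <-> (1 < h)%N.
Proof.
split=> [/branch_value_Lambda[] //| h1].
(* The point 1 is always a root of U^A - 1, so it has index [h]. *)
by exists (Some 1); rewrite /lies_over ram_index_Lambda_root ?expr1n.
Qed.

End Lambda.

(** * The extension k(X)/k(f) *)

Lemma fmorph_inverse (E K : fieldType) (g : {rmorphism E -> K}) :
  (forall x, exists y, g y = x) ->
  exists2 phi : {rmorphism K -> E}, cancel phi g & cancel g phi.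
Proof.
move=> surj; have surj' x : exists y, g y == x.
  by have [y <-] := surj x; exists y.
pose phi x := xchoose (surj' x).
have phiK : cancel phi g by move=> x; apply/eqP/(xchooseP (surj' x)).
have gK : cancel g phi by move=> y; apply: (fmorph_inj g); rewrite phiK.
have phiB : zmod_morphism phi := can2_zmod_morphism gK phiK.
have phiM : monoid_morphism phi := can2_monoid_morphism gK phiK.
pose phiA := GRing.isZmodMorphism.Build K E phi phiB.
pose phiR := GRing.isMonoidMorphism.Build K E phi phiM.
pose phi' : {rmorphism K -> E} := HB.pack phi phiA phiR.
by exists phi'.
Qed.

(** A polynomial of least degree vanishing at [z] is irreducible, so F[X]/(p) is a field. It embeds
    in [K] by X -> z, onto since [z] generates [K], and [phi] is the inverse. *)
Lemma simple_ext_iso (F K : fieldType) (i : {rmorphism F -> K}) (z : K)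
    (p : {poly F}) :
    p != 0 -> root (map_poly i p) z ->
    (forall q, root (map_poly i q) z -> q != 0 -> (size p <= size q)%N) ->
    (forall x, exists q r, x = (map_poly i q).[z] / (map_poly i r).[z]) ->
  exists (L : fieldExtType F) (phi : {rmorphism K -> L}),
    ext_iso i phi /\ \dim {:L} = (size p).-1.
Proof.
move=> p0 pz minp genz.
have irrp : irreducible_poly p by apply/(subfx_irreducibleP pz p0).
pose L : fieldExtType F := SubFieldExtType pz irrp.
pose g : {rmorphism L -> K} := subfx_inj.
have [|phi phiK gK] := @fmorph_inverse L K g.
  move=> x; have [q [r ->]] := genz x.
  exists ((subfx_eval i z p q : L) / (subfx_eval i z p r : L)).
  by rewrite fmorph_div /= !subfx_inj_eval.
exists L, phi; split; last by rewrite dimvf.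
split; first by exists g.
move=> x; apply: (can_inj gK); rewrite phiK.
by rewrite /= subfx_inj_base.
Qed.

Section PullbackExtension.

Variable k : fieldType.
Implicit Types (f g p q : {poly k}) (x : {ratfun k}).

Lemma pullback_comp f g x : (1 < size f)%N -> (1 < size g)%N ->
  pullback f (pullback g x) = pullback (g \Po f) x.
Proof.
(* Degrees multiply, so the composite is nonconstant and its [pullback] is not in the default case
   either. *)
move=> f1 g1; have fg1 : (1 < size (g \Po f))%N.
  rewrite -subn_gt0 subn1 size_comp_poly muln_gt0 -!subn1 !subn_gt0.
  by rewrite g1.
rewrite [x in LHS]divrfE [x in RHS]divrfE.
have d0 := denrf_neq0 x.
rewrite !pullback_div ?comp_poly_eq0f //.
by rewrite !comp_polyA.
Qed.

Lemma pullbackC f (c : k) : pullback f c%:P%:RF = c%:P%:RF.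
Proof.
have [f1|f1] := boolP (1 < size f)%N; last by rewrite /pullback (negPf f1).
by rewrite pullback_poly // comp_polyC.
Qed.

Lemma ratfun_morph_ext (L : fieldType) (f g : {rmorphism {ratfun k} -> L}) :
  (forall c : k, f c%:P%:RF = g c%:P%:RF) -> f 'X%:RF = g 'X%:RF -> f =1 g.
Proof.
move=> fgC fgX x; have fgp p : f p%:RF = g p%:RF.
  elim/poly_ind: p => [|p c IHp]; first by rewrite !tofrac0 !rmorph0.
  by rewrite tofracD tofracM !rmorphD !rmorphM /= IHp fgX fgC.
by rewrite [x]divrfE !fmorph_div /= !fgp.
Qed.

Lemma horner_map_ratfun f (c : nat -> {poly k}) n : (1 < size f)%N ->
  (map_poly (pullback f) (\poly_(j < n) (c j)%:RF)).['X%:RF] =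
  (\sum_(j < n) (c j \Po f) * 'X^j)%:RF.
Proof.
move=> f1; rewrite poly_def rmorph_sum horner_sum rmorph_sum.
apply: eq_bigr => j _; rewrite /= map_polyZ map_polyXn hornerZ hornerXn /=.
by rewrite pullback_poly // tofracM tofracXn.
Qed.

(* The powers of X below the degree of f are independent over k[f]: compare
   the remainders modulo f, then divide the relation by f. *)
Lemma base_comp_eq0 f (c : nat -> {poly k}) n : (n < size f)%N ->
  \sum_(j < n) (c j \Po f) * 'X^j = 0 -> forall j, (j < n)%N -> c j = 0.
Proof.
move=> nf; have := fun j (jn : (j < n)%N) =>
  leq_bigmax (F := fun j : 'I_n => size (c j)) (Ordinal jn).
move: (\max_(j < n) _)%N => m; elim: m c => [|m IHm] c /= cm sum0.
  by move=> j jn; apply/eqP; rewrite -size_poly_leq0; apply: cm jn.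
have f0 : f != 0 by rewrite -size_poly_gt0 (leq_ltn_trans _ nf).
pose d j := drop_poly 1 (c j); pose r : {poly k} := \poly_(j < n) (c j)`_0.
have cE j : c j = d j * 'X + ((c j)`_0)%:P.
  rewrite -[LHS](poly_take_drop 1) addrC expr1; congr (_ + _).
  by apply/polyP=> -[|i]; rewrite coef_take_poly coefC.
have sumE : \sum_(j < n) (c j \Po f) * 'X^j =
    (\sum_(j < n) (d j \Po f) * 'X^j) * f + r.
  rewrite /r poly_def mulr_suml -big_split /=; apply: eq_bigr => j _.
  rewrite {1}cE comp_polyD comp_polyM comp_polyX comp_polyC mulrDl mul_polyC.
  by rewrite mulrAC.
have r0 : r = 0 /\ \sum_(j < n) (d j \Po f) * 'X^j = 0.
  have rf : (size r < size f)%N by apply: leq_ltn_trans nf; apply: size_poly.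
  have := congr1 (fun q => q %% f)%R sumE.
  rewrite sum0 mod0p modpD modp_mull add0r modp_small // => r0.
  move/eqP: sumE; rewrite sum0 -r0 addr0 eq_sym mulf_eq0 (negPf f0) orbF.
  by move/eqP.
case: r0 => r0 d0 j jn.
have cj0 : (c j)`_0 = 0.
  by have := congr1 (fun q : {poly k} => q`_j) r0; rewrite coef_poly jn coef0.
rewrite cE cj0 addr0 (IHm d) ?mul0r // => l ln.
by rewrite size_drop_poly leq_subLR add1n; apply: cm.
Qed.

(** Clears denominators in a polynomial over k(T), which turns independence over k[f] into
    independence over k(f). *)
Lemma common_denominator (u : nat -> {ratfun k}) n :
  exists2 d : {poly k}, d != 0 &
    exists c : nat -> {poly k}, forall j, (j < n)%N -> d%:RF * u j = (c j)%:RF.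
Proof.
elim: n => [|n [d d0 [c cP]]].
  by exists 1; rewrite ?oner_neq0; last exists (fun=> 0).
exists (d * denrf (u n)); first by rewrite mulf_neq0 ?denrf_neq0.
exists (fun j => if j == n then d * numrf (u n) else denrf (u n) * c j) => j.
rewrite ltnS leq_eqVlt; case: eqP => [-> _ | _ /= jn].
  rewrite {2}[u n]divrfE !tofracM -mulrA; congr (_ * _); rewrite mulrC divfK //.
  by rewrite tofrac_eq0 denrf_neq0.
by rewrite !tofracM mulrAC cP // mulrC.
Qed.

(** As a ring morphism, this lets [map_poly ratfunC f] be f(Y) with coefficients in k(T). *)
Definition ratfunC (c : k) : {ratfun k} := c%:P%:RF.

Lemma ratfunC_is_monoid_morphism : monoid_morphism ratfunC.
Proof.
by rewrite /ratfunC; split=> [|a b]; rewrite ?polyC1 ?tofrac1 // polyCM tofracM.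
Qed.

Lemma ratfunC_is_zmod_morphism : zmod_morphism ratfunC.
Proof. by move=> a b; rewrite /ratfunC polyCB tofracB. Qed.

HB.instance Definition _ :=
  GRing.isZmodMorphism.Build k {ratfun k} ratfunC ratfunC_is_zmod_morphism.
HB.instance Definition _ :=
  GRing.isMonoidMorphism.Build k {ratfun k} ratfunC ratfunC_is_monoid_morphism.

Lemma horner_map_ratfunC f g : (map_poly ratfunC f).[g%:RF] = (f \Po g)%:RF.
Proof.
elim/poly_ind: f => [|f c IHf].
  by rewrite comp_poly0 rmorph0 horner0 tofrac0.
rewrite comp_polyD comp_polyM comp_polyX comp_polyC tofracD tofracM -IHf.
by rewrite rmorphD rmorphM /= map_polyX map_polyC !hornerE.
Qed.

Lemma map_pullback_ratfunC f g :
  map_poly (pullback f) (map_poly ratfunC g) = map_poly ratfunC g.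
Proof. by apply/polyP=> j; rewrite !coef_map /= /ratfunC pullbackC. Qed.

Lemma pullback_ext_iso f : (1 < size f)%N ->
  exists (L : fieldExtType {ratfun k}) (phi : {rmorphism {ratfun k} -> L}),
    ext_iso (pullback f) phi /\ \dim {:L} = (size f).-1.
Proof.
(* [P] is f(Y) - T, which vanishes at Y = X once T is mapped to f(X). *)
move=> f1; pose P := map_poly ratfunC f - ('X%:RF)%:P.
have sP : size P = size f by rewrite size_subC size_map_poly.
rewrite -sP; apply: (@simple_ext_iso _ _ (pullback f) 'X%:RF).
- by rewrite -size_poly_gt0 sP ltnW.
- rewrite rootE rmorphB /= map_pullback_ratfunC map_polyC hornerD hornerN.
  rewrite hornerC horner_map_ratfunC comp_polyXr /= pullback_poly //.
  by rewrite comp_polyX subrr.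
(* A nonzero [q] of degree below deg f vanishing at X would, denominators cleared, be a dependence
   over k[f] between powers of X below deg f. *)
- move=> q qX q0; rewrite leqNgt sP; apply/negP=> sq.
  have [d d0 [c cP]] := common_denominator (fun j => q`_j) (size q).
  have dq : d%:RF *: q = \poly_(j < size q) (c j)%:RF.
    apply/polyP=> j; rewrite coefZ coef_poly; case: ltnP => [/cP //|sj].
    by rewrite nth_default ?mulr0.
  have: root (map_poly (pullback f) (d%:RF *: q)) 'X%:RF.
    apply/rootP; rewrite map_polyZ hornerZ (rootP qX); exact: mulr0.
  rewrite dq rootE horner_map_ratfun // tofrac_eq0.
  move=> /eqP/(base_comp_eq0 sq) c0.
  suffices: d%:RF *: q = 0.
    by move/eqP; rewrite scaler_eq0 tofrac_eq0 (negPf d0) (negPf q0).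
  rewrite dq; apply/polyP=> j; rewrite coef_poly coef0.
  by case: ltnP => // /c0 ->.
move=> x; exists (map_poly ratfunC (numrf x)), (map_poly ratfunC (denrf x)).
by rewrite !map_pullback_ratfunC !horner_map_ratfunC !comp_polyXr -divrfE.
Qed.

End PullbackExtension.

(** * Galois closure and monodromy *)

Lemma comp_poly_exp (R : comNzRingType) (f g : {poly R}) n :
  f ^+ n \Po g = (f \Po g) ^+ n.
Proof. exact: (rmorphXn (comp_poly g)). Qed.

(** The N-th power is additive in characteristic p, so z^N - z is additive; it kills [b] and
    commutes with scaling by [a]. *)
Lemma artin_schreier_comp (k : fieldType) (p e N : nat) (a b : k) :
    p \in [pchar k] -> N = (p ^ e)%N -> a ^+ N = a -> b ^+ N = b ->
  ('X^N - 'X) \Po (a *: 'X + b%:P) = a *: ('X^N - 'X).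
Proof.
move=> hk hN aN bN; rewrite comp_polyB comp_poly_exp comp_polyX exprDn_pchar.
  by rewrite exprZn aN -polyC_exp bN scalerBr opprD addrACA subrr addr0.
rewrite hN pnatX pnatE ?(pcharf_prime hk) //.
by rewrite (rmorph_pchar (@polyC k) hk).
Qed.

(** The exponent A h = N - 1 makes the composite z^h (z^(N - 1) - 1)^h, an h-th power. *)
Lemma Lambda_comp_Xh (k : fieldType) N h :
    (0 < N)%N -> (0 < h)%N -> (h %| N.-1)%N ->
  Lambda k N h \Po 'X^h = ('X^N - 'X) ^+ h.
Proof.
move=> N0 h0 hd; rewrite /Lambda comp_polyM comp_polyX comp_poly_exp.
rewrite comp_polyB comp_poly_exp comp_polyX comp_polyC -exprM mulnC divnK //.
by rewrite -exprMn mulrBr mulr1 -exprS prednK.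
Qed.

Lemma size_artin_schreier (R : fieldType) N h : (1 < N)%N ->
  size (('X^N - 'X) ^+ h : {poly R}) = (N * h).+1.
Proof.
move=> N1; have s : size ('X^N - 'X : {poly R}) = N.+1.
  by rewrite size_polyDl size_polyXn // size_polyN size_polyX ltnS.
have n0 : ('X^N - 'X : {poly R}) != 0 by rewrite -size_poly_gt0 s.
by rewrite -[LHS]prednK ?size_poly_gt0 ?expf_neq0 // size_exp s.
Qed.

Section Closure.

Variables (k : fieldType) (p e N h : nat) (FN : finFieldType).
Variables (iota : {rmorphism FN -> k}) (Hh : {group {unit FN}}).
Hypotheses (hk : p \in [pchar k]) (hN : N = (p ^ e)%N) (hFN : #|FN| = N).
Hypotheses (h0 : (0 < h)%N) (hd : (h %| N.-1)%N) (hHh : #|Hh| = h).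

Local Notation AS := (('X^N - 'X) ^+ h : {poly k}).
Local Notation F := {ratfun k}.

Let N1 : (1 < N)%N. Proof. by rewrite -hFN finNzRing_gt1. Qed.
Let N0 : (0 < N)%N := ltnW N1.

Let AS_gt1 : (1 < size AS)%N.
Proof. by rewrite size_artin_schreier // ltnS muln_gt0 N0. Qed.

Definition aff (a : {unit FN}) (b : FN) : {poly k} :=
  iota (FinRing.uval a) *: 'X + (iota b)%:P.

Lemma unit_exp_h a : a \in Hh -> iota (FinRing.uval a) ^+ h = 1.
Proof.
move=> aH; rewrite -rmorphXn -FinRing.val_unitX -hHh expg_cardG //.
by rewrite rmorph1.
Qed.

Lemma iota_expN b : iota b ^+ N = iota b.
Proof. by rewrite -rmorphXn -hFN expf_card. Qed.

Lemma AS_comp_aff a b : a \in Hh -> AS \Po aff a b = AS.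
Proof.
move=> aH; rewrite comp_poly_exp (artin_schreier_comp hk hN) ?iota_expN //.
by rewrite exprZn unit_exp_h // scale1r.
Qed.

(** Translation by [b] fixes (z^N - z)^h, so (z + b)^h satisfies the same equation over k(T) as U =
    z^h. *)
Lemma Lambda_comp_aff b : Lambda k N h \Po (aff 1%g b) ^+ h = AS.
Proof.
have -> : aff 1%g b ^+ h = 'X^h \Po aff 1%g b.
  by rewrite comp_poly_exp comp_polyX.
rewrite comp_polyA Lambda_comp_Xh //.
by rewrite AS_comp_aff ?group1.
Qed.

Lemma aff_inj a b a' b' : aff a b = aff a' b' -> a = a' /\ b = b'.
Proof.
move=> E; split.
  have := congr1 (fun q : {poly k} => q`_1) E.
  by rewrite !coefD !coefZ !coefX !coefC !mulr1 !addr0 => /fmorph_inj/val_inj.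
have := congr1 (fun q : {poly k} => q`_0) E.
by rewrite !coefD !coefZ !coefX !coefC !mulr0 !add0r => /fmorph_inj.
Qed.

(** * The splitting field of (Y^N - Y)^h - T *)

Section Splitting.

Variables (L : fieldExtType F) (phi : {rmorphism F -> L}).
Hypothesis phi_iso : ext_iso (pullback AS) phi.

Let phi_alg x : phi (pullback AS x) = x%:A.
Proof. by have [_ ->] := phi_iso. Qed.

(** Here ['X%:RF%:A] is the image of T in [L]. *)
Definition aff_poly : {poly L} := ('X^N - 'X) ^+ h - ('X%:RF%:A)%:P.

Definition aff_roots : seq L :=
  [seq phi (aff u.1 u.2)%:RF | u <- enum (setX Hh [set: FN])].

Lemma phi_constE c : phi c%:P%:RF = (c%:P%:RF : F)%:A.
Proof. by rewrite -phi_alg pullbackC. Qed.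

Lemma root_aff_poly (x : L) :
  root aff_poly x = ((x ^+ N - x) ^+ h == 'X%:RF%:A).
Proof.
by rewrite rootE !(hornerD, hornerN, hornerC, horner_exp, hornerX) subr_eq0.
Qed.

Lemma uniq_aff_roots : uniq aff_roots.
Proof.
rewrite map_inj_uniq ?enum_uniq // => -[a b] [a' b'] /= /fmorph_inj/eqP.
by rewrite tofrac_eq => /eqP/aff_inj[-> ->].
Qed.

(** The N h elements a z + b are distinct roots of a monic polynomial of degree N h. *)
Lemma aff_polyE : aff_poly = \prod_(x <- aff_roots) ('X - x%:P).
Proof.
have sP : size aff_poly = (N * h).+1.
  by rewrite size_subC ?size_artin_schreier // ltnS muln_gt0 N0.
have mP : lead_coef aff_poly = 1.
  rewrite lead_coefDl.
    rewrite lead_coef_exp lead_coefDl ?lead_coefXn ?expr1n //.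
    by rewrite size_polyXn size_polyN size_polyX ltnS.
  rewrite size_polyN size_artin_schreier //.
  rewrite (leq_ltn_trans (size_polyC_leq1 _)) //.
  by rewrite ltnS muln_gt0 N0.
rewrite -[RHS]scale1r -mP; apply: all_roots_prod_XsubC.
- by rewrite sP size_map -cardE cardsX hHh cardsT hFN mulnC.
- apply/allP=> _ /mapP[[a b] /[!mem_enum]/setXP[aH _] ->].
  rewrite root_aff_poly -phi_alg pullback_poly // comp_polyX.
  by rewrite -!rmorphXn -!rmorphB -!rmorphXn -(AS_comp_aff b aH) comp_poly_exp
    comp_polyB comp_poly_exp comp_polyX.
by rewrite uniq_rootsE uniq_aff_roots.
Qed.

Lemma aff_polyOver : aff_poly \is a polyOver 1%VS.
Proof.
by rewrite rpredB ?rpredX ?rpredB ?rpredX ?polyOverX // polyOverC memvZ ?mem1v.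
Qed.

(** The constants come from the base field k(T), so [z] alone generates [L]. *)
Lemma subfield_full (M : {subfield L}) :
  phi 'X%:RF \in M -> (M = {:L} :> {vspace L})%VS.
Proof.
move=> zM; apply/vspaceP=> x; rewrite memvf.
have [[psi _ psiK] _] := phi_iso; rewrite -[x]psiK.
have pM q : phi q%:RF \in M.
  elim/poly_ind: q => [|q c qM]; first by rewrite tofrac0 rmorph0 mem0v.
  rewrite tofracD tofracM rmorphD rmorphM /= rpredD ?rpredM //.
  by rewrite phi_constE memvZ ?mem1v.
rewrite [psi x]divrfE fmorph_div /=; apply: rpred_div; exact: pM.
Qed.

Lemma aff_splitting : splittingFieldFor 1 aff_poly {:L}.
Proof.
exists aff_roots; first by rewrite aff_polyE eqpxx.
apply: (subfield_full (M := <<1 & aff_roots>>%AS)).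
(* The generator z is itself the root with a = 1 and b = 0. *)
apply: seqv_sub_adjoin; apply/mapP; exists (1%g, 0).
  by rewrite mem_enum inE group1 inE.
by rewrite /aff /= rmorph1 rmorph0 scale1r polyC0 addr0.
Qed.

Lemma aff_separable : separable_poly aff_poly.
Proof. by rewrite aff_polyE separable_prod_XsubC uniq_aff_roots. Qed.

End Splitting.

(** * The Galois group and its action on the conjugates of U *)

Section Monodromy.

Variables (L : splittingFieldType F) (phi : {rmorphism F -> L}).
Hypothesis phi_iso : ext_iso (pullback AS) phi.
Hypothesis dimL : \dim {:L} = (N * h)%N.

Local Notation lambda := (pullback (Lambda k N h)).
Local Notation Gal := 'Gal({:L} / 1)%g.

Let phi_alg x : phi (pullback AS x) = x%:A.
Proof. by have [_ ->] := phi_iso. Qed.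

Let Lambda_gt1 : (1 < size (Lambda k N h))%N.
Proof. by rewrite (@size_Lambda_gt1 _ _ _ (N.-1 %/ h)) // divnK. Qed.

Lemma galois_closureL : galois 1 {:L}.
Proof.
apply/splitting_galoisField; exists (aff_poly L).
split; first exact: aff_polyOver.
  exact: (aff_separable phi_iso).
exact: (aff_splitting phi_iso).
Qed.

Lemma card_Gal : #|Gal| = (N * h)%N.
Proof. by rewrite -(galois_dim galois_closureL) dimv1 divn1 dimL. Qed.

(* The conjugates of [U = z^h] are the [(z + s)^h], for [s] in [FN]. *)
Definition sheet (s : FN) : {rmorphism F -> L} :=
  phi \o pullback (aff 1%g s ^+ h).

Let aff1_gt1 s : (1 < size (aff 1%g s ^+ h))%N.
Proof.
have sz : size (aff 1%g s) = 2%N.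
  by rewrite /aff rmorph1 scale1r -[X in _ + X]opprK -polyCN size_XsubC.
have nz : aff 1%g s != 0 by rewrite -size_poly_gt0 sz.
by rewrite -[size _]prednK ?size_poly_gt0 ?expf_neq0 // size_exp sz mul1n ltnS.
Qed.

Lemma sheet_ext_hom s : ext_hom lambda (sheet s).
Proof. by move=> x; rewrite /= pullback_comp // Lambda_comp_aff phi_alg. Qed.

Lemma sheetX s : sheet s 'X%:RF = phi (aff 1%g s)%:RF ^+ h.
Proof. by rewrite /= pullback_poly // comp_polyX -!rmorphXn. Qed.

Lemma sheet_inj s t : sheet s 'X%:RF = sheet t 'X%:RF -> s = t.
Proof.
rewrite !sheetX -!rmorphXn => /fmorph_inj/eqP.
rewrite tofrac_eq => /eqP E.
(* Evaluating (z + s)^h = (z + t)^h at z = -s leaves (t - s)^h = 0. *)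
have := congr1 (horner^~ (- iota s)) E.
rewrite !horner_exp /aff rmorph1 !scale1r !hornerD !hornerX !hornerC addNr.
rewrite expr0n gtn_eqF // => /esym/eqP; rewrite expf_eq0 h0 /= addrC subr_eq0.
by move=> /eqP/fmorph_inj.
Qed.

Lemma ext_hom_const (f : {rmorphism F -> L}) (c : k) :
  ext_hom lambda f -> f c%:P%:RF = (c%:P%:RF : F)%:A.
Proof. by move=> fE; rewrite -fE /= pullbackC. Qed.

Lemma ext_hom_root (f : {rmorphism F -> L}) : ext_hom lambda f ->
  root (Lambda L N h - ('X%:RF%:A)%:P) (f 'X%:RF).
Proof.
move=> fE; rewrite rootE /Lambda hornerD hornerN hornerC hornerM hornerX.
rewrite horner_exp hornerD hornerN hornerXn hornerC -fE /= pullback_poly //.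
rewrite comp_polyX /Lambda tofracM tofracXn tofracB tofracXn tofrac1.
by rewrite rmorphM rmorphXn rmorphB rmorphXn rmorph1 subrr.
Qed.

(** The sheets give N distinct roots of Lambda(Y) - T, which has degree N. Hence f(U) is one of
    them, and f(U) determines [f]. *)
Lemma ext_hom_sheet (f : {rmorphism F -> L}) : ext_hom lambda f ->
  exists s, f =1 sheet s.
Proof.
move=> fE; have := ext_hom_root fE; set P := _ - _ => Pf.
pose rs := [seq sheet s 'X%:RF | s <- enum FN].
have hA : N.-1 = (N.-1 %/ h * h)%N by rewrite divnK.
have sP : size P = N.+1 by rewrite size_subC ?(size_Lambda _ N1 h0 hA).
have rsP : all (root P) rs.
  by apply/allP=> _ /mapP[s _ ->]; apply: ext_hom_root (sheet_ext_hom s).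
have rsU : uniq_roots rs.
  by rewrite uniq_rootsE map_inj_uniq ?enum_uniq // => s t /sheet_inj.
have PE := all_roots_prod_XsubC _ rsP rsU.
have P0 : lead_coef P != 0 by rewrite lead_coef_eq0 -size_poly_gt0 sP.
move: Pf; rewrite PE ?rootZ // ?root_prod_XsubC; last first.
  by rewrite sP size_map -cardE hFN.
move=> /mapP[s _ fs]; exists s; apply: ratfun_morph_ext fs => c.
by rewrite !ext_hom_const //; apply: sheet_ext_hom.
Qed.

Lemma gal_sheet_ext_hom (g : gal_of {:L}) s : ext_hom lambda (g \o sheet s).
Proof.
by move=> x /=; rewrite -[phi _]/(sheet s _) sheet_ext_hom rmorph_alg.
Qed.

(** Composing a k(T)-embedding with [g] gives another one. The boolean equality allows [xchoose] to
    pick its index. *)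
Lemma gal_sheet (g : gal_of {:L}) s :
  exists t, g (sheet s 'X%:RF) == sheet t 'X%:RF.
Proof.
have [t tE] := ext_hom_sheet (gal_sheet_ext_hom g s).
by exists t; rewrite -tE.
Qed.

Definition mono_fun (g : gal_of {:L}) s : FN := xchoose (gal_sheet g s).

Lemma mono_funP (g : gal_of {:L}) s :
  g (sheet s 'X%:RF) = sheet (mono_fun g s) 'X%:RF.
Proof. exact/eqP/(xchooseP (gal_sheet g s)). Qed.

Lemma mono_fun_inj g : injective (mono_fun g).
Proof.
move=> s t st; have := mono_funP g s.
by rewrite st -mono_funP => /fmorph_inj/sheet_inj.
Qed.

Definition mono_perm g : {perm FN} := perm (@mono_fun_inj g).

Lemma mono_permP (g : gal_of {:L}) s y :
  g (sheet s y) = sheet (mono_perm g s) y.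
Proof.
move: y; apply: (ratfun_morph_ext (f := g \o sheet s)) => [c|].
  rewrite !ext_hom_const //; first exact: sheet_ext_hom.
  exact: gal_sheet_ext_hom.
by rewrite permE -mono_funP.
Qed.

(** Products of automorphisms and of permutations both apply the left factor first, so the order is
    kept. *)
Lemma mono_permM : {in Gal &, {morph mono_perm : g g' / (g * g')%g}}.
Proof.
move=> g g' _ _; apply/permP=> s; apply: sheet_inj; rewrite permM.
by rewrite -!mono_permP galM ?memvf.
Qed.

Definition monodromy : {morphism Gal >-> {perm FN}} := Morphism mono_permM.

(** An automorphism sends [z] to another root of (Y^N - Y)^h - T. *)
Lemma gal_aff (g : gal_of {:L}) : exists a b, a \in Hh /\
  g (phi 'X%:RF) = phi (aff a b)%:RF.
Proof.
have zE : (phi 'X%:RF ^+ N - phi 'X%:RF) ^+ h = 'X%:RF%:A.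
  rewrite -phi_alg /= pullback_poly // comp_polyX tofracXn tofracB tofracXn.
  by rewrite rmorphXn rmorphB rmorphXn.
have: root (aff_poly L) (g (phi 'X%:RF)).
  have := congr1 g zE; rewrite rmorph_alg rmorphXn rmorphB rmorphXn => /eqP.
  by rewrite root_aff_poly.
rewrite (aff_polyE phi_iso) root_prod_XsubC => /mapP[[a b]].
rewrite mem_enum => /setXP[aH _] E.
by exists a, b.
Qed.

Lemma gal_phi_poly (g : gal_of {:L}) q :
  g (phi q%:RF) = (map_poly (phi \o @ratfunC k) q).[g (phi 'X%:RF)].
Proof.
elim/poly_ind: q => [|q c IHq].
  by rewrite tofrac0 !rmorph0 horner0.
rewrite tofracD tofracM !rmorphD !rmorphM /= map_polyX map_polyC hornerMXaddC.
by rewrite IHq /= /ratfunC (phi_constE phi_iso) rmorph_alg.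
Qed.

(* If [g z = a z + b] then [g] maps [(z + s)^h] to [(a z + b + s)^h], which is
   [(z + (b + s) / a)^h] since [a^h = 1]. *)
Lemma mono_perm_aff (g : gal_of {:L}) a b : a \in Hh ->
    g (phi 'X%:RF) = phi (aff a b)%:RF ->
  mono_perm g = affine a^-1 (FinRing.uval a^-1%g * b).
Proof.
move=> aH gz; apply/permP=> s; apply: sheet_inj; rewrite -mono_permP !sheetX.
have gs : g (phi (aff 1%g s)%:RF) = phi (aff a (b + s))%:RF.
  rewrite gal_phi_poly gz /aff rmorph1 scale1r rmorphD /= map_polyX map_polyC.
  rewrite hornerD hornerX hornerC /= -rmorphD -tofracD -addrA -polyCD.
  by rewrite -rmorphD.
have aE : aff a (b + s) =
    iota (FinRing.uval a) *: aff 1%g (affine a^-1 (FinRing.uval a^-1%g * b) s).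
  rewrite /aff rmorph1 scale1r scalerDr -mul_polyC -[_ *: _%:P]mul_polyC.
  rewrite -polyCM -rmorphM permE /= -mulrDr mulrA mulrV ?(valP a) // mul1r.
  by rewrite mul_polyC [s + b]addrC.
by rewrite rmorphXn /= gs -!rmorphXn aE exprZn unit_exp_h // scale1r.
Qed.

Lemma gal_eq1 (g : gal_of {:L}) : g (phi 'X%:RF) = phi 'X%:RF -> g = 1%g.
Proof.
move=> gz; apply/eqP/gal_eqP => x _; rewrite gal_id.
have [[psi _ psiK] _] := phi_iso; rewrite -[x]psiK; move: (psi x).
apply: (ratfun_morph_ext (f := g \o phi)) => //= c.
by rewrite (phi_constE phi_iso) rmorph_alg.
Qed.

Lemma mono_perm1 (g : gal_of {:L}) : mono_perm g = 1%g -> g = 1%g.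
Proof.
have [a [b [aH gz]]] := gal_aff g; rewrite (mono_perm_aff aH gz) => E.
(* An affine map is determined by its values at 0 and 1: the first gives b = 0, then the second
   gives a = 1. *)
have b0 : b = 0.
  have := congr1 (fun f : {perm FN} => f 0) E; rewrite !permE /= mulr0 add0r.
  by move/(canRL (mulKr (valP a^-1%g))); rewrite mulr0 => ->.
have a1 : a = 1%g.
  have := congr1 (fun f : {perm FN} => f 1) E; rewrite !permE /= b0 mulr0 addr0.
  rewrite mulr1 => aV; apply: invg_inj; apply: val_inj.
  by rewrite /= aV invr1.
by apply: gal_eq1; rewrite gz a1 b0 /aff rmorph1 rmorph0 scale1r polyC0 addr0.
Qed.

Lemma injm_monodromy : ('injm monodromy)%g.
Proof.
apply/subsetP=> g /morphpreP[_]; rewrite inE => /eqP/mono_perm1 ->.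
exact: set11.
Qed.

Lemma leq_card_affine_group : (#|affine_group Hh| <= N * h)%N.
Proof.
rewrite affine_groupE curry_imset2X (leq_trans (leq_imset_card _ _)) //.
by rewrite cardsX hHh cardsT hFN mulnC.
Qed.

(** The image lies in the affine group and has N h elements by injectivity, while the affine group
    has at most N h. *)
Lemma monodromy_im : (monodromy @* Gal)%g = affine_group Hh.
Proof.
apply/eqP; rewrite eqEcard; apply/andP; split; last first.
  by rewrite (card_injm injm_monodromy) // card_Gal leq_card_affine_group.
apply/subsetP=> _ /morphimP[g _ _ ->].
have [a [b [aH gz]]] := gal_aff g; rewrite affine_groupE.
apply/imset2P; exists a^-1%g (FinRing.uval a^-1%g * b); rewrite ?inE ?groupV //.
exact: mono_perm_aff aH gz.
Qed.

Lemma monodromy_isom : isom Gal (affine_group Hh) monodromy.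
Proof. exact: sub_isom (subxx _) monodromy_im injm_monodromy. Qed.

Lemma closure_monodromy_iso : monodromy_iso lambda L (affine_group Hh).
Proof.
exists sheet, monodromy; split.
- move=> s; exact: sheet_ext_hom.
- by move=> s t st; apply/sheet_inj/st.
- move=> f; exact: ext_hom_sheet.
- exact: monodromy_isom.
- by move=> g _ s y; apply: mono_permP.
Qed.

(* A subextension that is normal and contains one sheet contains all of them,
   since the monodromy group contains the translations. *)
Lemma closure_is_galois_closure :
  is_galois_closure lambda (phi \o pullback 'X^h).
Proof.
have jE y : phi (pullback 'X^h y) = sheet 0 y.
  by rewrite /= /aff rmorph1 rmorph0 scale1r polyC0 addr0.
split; first by move=> x; rewrite /= jE; apply: sheet_ext_hom.
  exact: galois_closureL.
move=> M jM galM.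
have sheetM t : sheet t 'X%:RF \in M.
  have : affine 1%g t \in affine_group Hh.
    by rewrite affine_groupE; apply/imset2P; exists 1%g t; rewrite ?group1 ?inE.
  rewrite -monodromy_im; case/morphimP=> g _ _ gt.
  have -> : t = mono_perm g 0 by rewrite -[mono_perm g]gt permE /= mulr0 add0r.
  have /and3P[_ _ /forall_inP nM] := galM; rewrite -mono_permP -jE.
  have /eqP <- : (g @: M == M)%VS by apply: nM; rewrite inE kAutfE k1AHom.
  exact: memv_img (jM 'X%:RF).
have galML : galois M {:L}.
  by apply: galoisS galois_closureL; rewrite sub1v subvf.
move/galois_fixedField: galML => <-; apply/vspaceP=> x; rewrite memvf.
apply/fixedFieldP; first exact: memvf.
(* An automorphism fixing [M] fixes all sheets, so faithfulness makes it the identity and the fixed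
   field of Gal(L/M) is all of [L]. *)
move=> g gM; suffices -> : g = 1%g by rewrite gal_id.
apply: mono_perm1; apply/permP=> s; apply: sheet_inj; rewrite perm1.
rewrite -mono_permP; exact: (fixed_gal (subvf M) gM (sheetM s)).
Qed.

End Monodromy.

(** The field extension built from [pullback_ext_iso] is upgraded to a splitting field by means of
    [aff_poly]. *)
Lemma closure_exists :
  exists (L : splittingFieldType F) (phi : {rmorphism F -> L}),
    ext_iso (pullback AS) phi /\ \dim {:L} = (N * h)%N.
Proof.
have [L [phi [phi_iso dimL]]] := pullback_ext_iso AS_gt1.
have splitL : SplittingField.axiom L.
  exists (aff_poly L); first exact: aff_polyOver.
  exact: (aff_splitting phi_iso).
pose SL : splittingFieldType F :=
  HB.pack L (FieldExt_isSplittingField.Build _ L splitL).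
exists SL, phi; split; first exact: phi_iso.
by rewrite dimL size_artin_schreier.
Qed.

End Closure.

(** For a generator x the power x^(|G|/n) has order n, and subgroups of a cyclic group are
    determined by their orders. For the units of F_N this is H_h. *)
Lemma cyclic_unique_subgroup (gT : finGroupType) (G : {group gT}) n :
    cyclic G -> (n %| #|G|)%N ->
  exists2 H : {group gT}, H \subset G &
    #|H| = n /\ forall K : {group gT}, K \subset G -> #|K| = n -> H = K.
Proof.
move=> cG dn; have /cyclicP[x Gx] := cG; move: (dn).
rewrite Gx -orderE => dx; exists <[x ^+ (#[x]%g %/ n)]>%G.
  exact: cycleX.
have Hn : #|<[x ^+ (#[x]%g %/ n)]>%g| = n.
  rewrite -orderE orderXdiv ?dvdn_div //.
  by rewrite divnA ?mulKn // ?order_gt0.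
split=> // K sK Kn; apply/val_inj/eqP; rewrite /= (eq_subG_cyclic cG) ?Gx //=.
  by rewrite Hn Kn.
exact: cycleX.
Qed.

Theorem theorem3p2 (p e N h A : nat) (hp : prime p) (he : (1 <= e)%N)
    (hN : N = (p ^ e)%N) (hh : (1 <= h)%N) (hdvd : (h %| N.-1)%N)
    (hA : A = (N.-1 %/ h)%N)
    (k : closedFieldType) (hk : p \in [pchar k])
    (FN : finFieldType) (hFN : #|FN| = N) :
  let lambda : {rmorphism {ratfun k} -> {ratfun k}} :=
    pullback (Lambda k N h) in
  [/\ ext_degree lambda N,
      exists (L : splittingFieldType {ratfun k})
             (phi : {rmorphism {ratfun k} -> L}),
        [/\ ext_iso (pullback (('X^N - 'X) ^+ h)) phi,
            is_galois_closure lambda (phi \o pullback 'X^h)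
          & exists Hh : {group {unit FN}},
              unique (fun H : {group {unit FN}} => #|H| = h) Hh /\
              monodromy_iso lambda L (affine_group Hh)],
      forall t : k, branch_value lambda (Some t) -> t = 0,
      [/\ lies_over lambda (Some 0) (Some 0),
          ram_index lambda (Some 0) (Some 0) = 1
        & forall u : k, u ^+ A = 1 ->
            lies_over lambda (Some u) (Some 0) /\
            ram_index lambda (Some u) (Some 0) = h%:Z]
    & [/\ lies_over lambda None None,
          ram_index lambda None None = N%:Z,
          (1 < h)%N -> forall Q : proj_line k,
            branch_value lambda Q <-> Q = Some 0 \/ Q = None
        & h = 1%N -> forall Q : proj_line k,
            branch_value lambda Q <-> Q = None]].
Proof.
have FN1 : (1 < N)%N by rewrite -hFN finNzRing_gt1.
have pN : (p %| N)%N by rewrite hN dvdn_exp.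
have NA : N.-1 = (A * h)%N by rewrite hA divnK.
have size_L := size_Lambda k FN1 hh NA.
move=> lambda; split.
- have [L [phi [phi_iso dimL]]] :=
    pullback_ext_iso (size_Lambda_gt1 k FN1 hh NA).
  by exists L, phi; split=> //; rewrite dimL size_L.
- have pF : p \in [pchar FN] by apply: card_finPcharP hp; rewrite hFN hN.
  have [iota] := finField_closed_embedding pF hk.
  have [||Hh _ [cHh uHh]] := @cyclic_unique_subgroup _ [set: {unit FN}]%G h.
  + exact: field_unit_group_cyclic.
  + by rewrite card_finField_unit hFN.
  have [L [phi [phi_iso dimL]]] := closure_exists iota hk hN hFN hh cHh.
  exists L, phi; split; first exact: phi_iso.
    exact: (closure_is_galois_closure iota hk hN hFN hh hdvd cHh phi_iso dimL).
  exists Hh; split; last first.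
    exact: (closure_monodromy_iso iota hk hN hFN hh hdvd cHh phi_iso dimL).
  by split=> // K cK; apply: uHh; rewrite ?subsetT.
- by move=> t /(branch_value_Lambda hk pN FN1 hh NA)[].
- have r0 := ram_index_Lambda0 k FN1 hh NA.
  split; rewrite /lies_over ?r0 // => u uA.
  by rewrite (ram_index_Lambda_root hk pN FN1 hh NA uA) ltz_nat.
have rN := ram_index_Lambda_infty k FN1 hh NA.
have bN := branch_value_Lambda_infty k FN1 hh NA.
split.
- by rewrite /lies_over rN ltz_nat ltnW.
- exact: rN.
- move=> h1 [t|]; split=> //; try by right.
    by move=> /(branch_value_Lambda hk pN FN1 hh NA)[-> _]; left.
  by case=> // -[->]; apply/(branch_value_Lambda0 hk pN FN1 hh NA).
move=> h1 [t|]; split=> //.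
(* A finite branch value would also force [1 < h]. *)
by move=> /(branch_value_Lambda hk pN FN1 hh NA)[_]; rewrite h1.
Qed.
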